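(* Let $G_0=\mathsf{Aff}(\mathbb{R})_0=\{(x,y)\in\mathbb{R}^2: x>0\}$, and let $\nabla_1$ and $\nabla_2$ be the left invariant connections on $G_0$ determined respectively by the following bilinear products on $\mathfrak{aff}(\mathbb{R})=\mathrm{Vect}_{\mathbb{R}}\{e_1,e_2\}$: $$\nabla_1:\quad e_1e_1=-e_1,\quad e_1e_2=e_2,\quad e_2e_1=0,\quad e_2e_2=0;$$ $$\nabla_2:\quad e_1e_1=-\tfrac12e_1,\quad e_1e_2=\tfrac12e_2,\quad e_2e_1=-\tfrac12e_2,\quad e_2e_2=0.$$ Let $a,b,d$ be real numbers with $a>0$. Then the map $$F(x,y)=(ax,\,-bx^{-1}+ay+d)$$ is a symplectomorphism of $(G_0,\omega^+)$ and an affine transformation of $(G_0,\nabla_1)$, and the map $$G(x,y)=(ax,\,-2b\sqrt{x}+ay+d)$$ is a symplectomorphism of $(G_0,\omega^+)$ and an affine transformation of $(G_0,\nabla_2)$.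
   Context: $\mathsf{Aff}(\mathbb{R})$ is the group of affine transformations of the real line, with natural coordinates $(x,y)$, $x\ne0$, and product $(x,y)(x',y')=(xx',xy'+y)$; $\mathsf{Aff}(\mathbb{R})_0$ is its identity component. The left invariant vector fields corresponding to the basis $(e_1,e_2)$ are $e_1^+=x\frac{\partial}{\partial x}$ and $e_2^+=x\frac{\partial}{\partial y}$, so $[e_1,e_2]=e_2$. The left invariant symplectic form is $\omega^+=-\frac{1}{x^2}\,dx\wedge dy$. The left invariant connection $\nabla$ determined by a bilinear product on the Lie algebra is given by $\nabla_{a^+}b^+=(ab)^+$. A symplectomorphism is a diffeomorphism $f$ with $f^*\omega^+=\omega^+$; an affine transformation is a diffeomorphism preserving the connection. *)

(* Defs.v *)
From Stdlib Require Import Reals Lra Lia.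
From Coquelicot Require Import Coquelicot.
Open Scope R_scope.

(* Functions, maps and vector fields on the open half-plane G0 are represented
   by total functions of the coordinates (x, y); every notion below quantifies
   over points of G0 only, so the values outside G0 are irrelevant. *)

Definition G0 (x y : R) : Prop := 0 < x.

Definition scalar_field := R -> R -> R.
Definition plane_map := R -> R -> R * R.
(* The pair is (X^1, X^2), standing for X^1 d/dx + X^2 d/dy. *)
Definition vector_field := R -> R -> R * R.

Definition smooth (f : scalar_field) : Prop :=
  forall (n : nat) (x y : R), G0 x y -> ex_diff_n f n x y.

Definition smooth2 (X : R -> R -> R * R) : Prop :=
  smooth (fun x y => fst (X x y)) /\ smooth (fun x y => snd (X x y)).

Definition eq_on_G0 {T : Type} (X Y : R -> R -> T) : Prop :=
  forall x y, G0 x y -> X x y = Y x y.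

Definition D1 (f : scalar_field) : scalar_field :=
  fun x y => Derive (fun t => f t y) x.
Definition D2 (f : scalar_field) : scalar_field :=
  fun x y => Derive (fun t => f x t) y.

Definition differential (F : plane_map) (x y : R) (v : R * R) : R * R :=
  let F1 := fun s t => fst (F s t) in
  let F2 := fun s t => snd (F s t) in
  (D1 F1 x y * fst v + D2 F1 x y * snd v,
   D1 F2 x y * fst v + D2 F2 x y * snd v).

Definition maps_G0 (F : plane_map) : Prop :=
  forall x y, G0 x y -> G0 (fst (F x y)) (snd (F x y)).

Definition diffeomorphism (F : plane_map) : Prop :=
  maps_G0 F /\ smooth2 F /\
  exists H : plane_map,
    maps_G0 H /\ smooth2 H /\
    (forall x y, G0 x y -> H (fst (F x y)) (snd (F x y)) = (x, y)) /\
    (forall x y, G0 x y -> F (fst (H x y)) (snd (H x y)) = (x, y)).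

(* For a diffeomorphism F, this determines X' = F_* X on G0. *)
Definition is_pushforward (F : plane_map) (X X' : vector_field) : Prop :=
  forall x y, G0 x y ->
    X' (fst (F x y)) (snd (F x y)) = differential F x y (X x y).

Definition two_form := R -> R -> R * R -> R * R -> R.

Definition pullback (F : plane_map) (w : two_form) : two_form :=
  fun x y u v =>
    w (fst (F x y)) (snd (F x y)) (differential F x y u) (differential F x y v).

Definition omega_plus : two_form :=
  fun x y u v => - (1 / x ^ 2) * (fst u * snd v - snd u * fst v).

Definition symplectomorphism (w : two_form) (F : plane_map) : Prop :=
  diffeomorphism F /\
  forall x y, G0 x y -> forall u v, pullback F w x y u v = w x y u v.

Definition aff_mul (g h : R * R) : R * R :=
  (fst g * fst h, fst g * snd h + snd g).

(* a^+ at g is the image of a under the differential at the identity (1, 0) of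
   the left translation by g. *)
Definition left_inv_field (a : R * R) : vector_field :=
  fun x y => differential (fun s t => aff_mul (x, y) (s, t)) 1 0 a.

Definition e1 : R * R := (1, 0).
Definition e2 : R * R := (0, 1).

(* The bilinear product with e_i e_j = uij. *)
Definition bilinear_product (u11 u12 u21 u22 : R * R) (a b : R * R) : R * R :=
  plus (plus (scal (fst a * fst b) u11) (scal (fst a * snd b) u12))
       (plus (scal (snd a * fst b) u21) (scal (snd a * snd b) u22)).

Definition product1 : R * R -> R * R -> R * R :=
  bilinear_product (opp e1) e2 zero zero.

Definition product2 : R * R -> R * R -> R * R :=
  bilinear_product (scal (- (1 / 2)) e1) (scal (1 / 2) e2)
                   (scal (- (1 / 2)) e2) zero.

Definition vf_plus (X Y : vector_field) : vector_field :=
  fun x y => plus (X x y) (Y x y).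
Definition vf_scal (f : scalar_field) (X : vector_field) : vector_field :=
  fun x y => scal (f x y) (X x y).
Definition vf_apply (X : vector_field) (f : scalar_field) : scalar_field :=
  fun x y => fst (X x y) * D1 f x y + snd (X x y) * D2 f x y.

Definition connection := vector_field -> vector_field -> vector_field.

(* R-linearity in the second argument is the case of a constant f in
   conn_leibniz. *)
Record is_connection (nabla : connection) : Prop := {
  conn_smooth : forall X Y, smooth2 X -> smooth2 Y -> smooth2 (nabla X Y);
  conn_ext : forall X X' Y Y', smooth2 X -> smooth2 X' -> smooth2 Y -> smooth2 Y' ->
    eq_on_G0 X X' -> eq_on_G0 Y Y' -> eq_on_G0 (nabla X Y) (nabla X' Y');
  conn_plus_l : forall X X' Y, smooth2 X -> smooth2 X' -> smooth2 Y ->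
    eq_on_G0 (nabla (vf_plus X X') Y) (vf_plus (nabla X Y) (nabla X' Y));
  conn_scal_l : forall f X Y, smooth f -> smooth2 X -> smooth2 Y ->
    eq_on_G0 (nabla (vf_scal f X) Y) (vf_scal f (nabla X Y));
  conn_plus_r : forall X Y Y', smooth2 X -> smooth2 Y -> smooth2 Y' ->
    eq_on_G0 (nabla X (vf_plus Y Y')) (vf_plus (nabla X Y) (nabla X Y'));
  conn_leibniz : forall f X Y, smooth f -> smooth2 X -> smooth2 Y ->
    eq_on_G0 (nabla X (vf_scal f Y))
             (vf_plus (vf_scal (vf_apply X f) Y) (vf_scal f (nabla X Y)))
}.

Definition left_inv_connection_of
    (prod : R * R -> R * R -> R * R) (nabla : connection) : Prop :=
  is_connection nabla /\
  forall a b, eq_on_G0 (nabla (left_inv_field a) (left_inv_field b))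
                       (left_inv_field (prod a b)).

Definition affine_transformation (nabla : connection) (F : plane_map) : Prop :=
  diffeomorphism F /\
  forall X Y X' Y', smooth2 X -> smooth2 Y -> smooth2 X' -> smooth2 Y' ->
    is_pushforward F X X' -> is_pushforward F Y Y' ->
    is_pushforward F (nabla X Y) (nabla X' Y').

Lemma bilinear_product_eq (u11 u12 u21 u22 a b : R * R) :
  bilinear_product u11 u12 u21 u22 a b =
  (fst a * fst b * fst u11 + fst a * snd b * fst u12 +
     (snd a * fst b * fst u21 + snd a * snd b * fst u22),
   fst a * fst b * snd u11 + fst a * snd b * snd u12 +
     (snd a * fst b * snd u21 + snd a * snd b * snd u22)).
Proof. reflexivity. Qed.

Lemma vf_plus_eq (X Y : vector_field) (x y : R) :
  vf_plus X Y x y = (fst (X x y) + fst (Y x y), snd (X x y) + snd (Y x y)).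
Proof. reflexivity. Qed.

Lemma vf_scal_eq (f : scalar_field) (X : vector_field) (x y : R) :
  vf_scal f X x y = (f x y * fst (X x y), f x y * snd (X x y)).
Proof. reflexivity. Qed.

Lemma left_inv_field_eq (a : R * R) (x y : R) :
  left_inv_field a x y = (x * fst a, x * snd a).
Proof.
unfold left_inv_field, differential, D1, D2, aff_mul; simpl.
assert (A : Derive (fun t => x * t) 1 = x)
  by (apply is_derive_unique; auto_derive; [easy | ring]).
assert (B : Derive (fun t : R => x * t + y) 0 = x)
  by (apply is_derive_unique; auto_derive; [easy | ring]).
rewrite A, B, !Derive_const; f_equal; ring.
Qed.

Lemma left_inv_field_e1 (x y : R) : left_inv_field e1 x y = (x, 0).
Proof. rewrite left_inv_field_eq; unfold e1; simpl; f_equal; ring. Qed.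

Lemma left_inv_field_e2 (x y : R) : left_inv_field e2 x y = (0, x).
Proof. rewrite left_inv_field_eq; unfold e2; simpl; f_equal; ring. Qed.

Lemma G0_locally_2d (x y : R) : G0 x y -> locally_2d G0 x y.
Proof.
unfold G0; intros Hx; exists (mkposreal x Hx); simpl; intros u v Hu _.
apply Rabs_def2 in Hu; lra.
Qed.

Lemma G0_locally_1 (x y : R) : G0 x y -> locally x (fun t => G0 t y).
Proof.
unfold G0; intros Hx; exists (mkposreal x Hx); simpl; intros u Hu.
apply Rabs_def2 in Hu; unfold minus, plus, opp in Hu; simpl in Hu; lra.
Qed.

(* A class of functions stable under partial derivatives, up to equality on G0,
   consists of smooth functions. *)
Lemma smooth_class (P : scalar_field -> Prop) :
  (forall f, P f ->
     (forall x y, G0 x y -> continuity_2d_pt f x y) /\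
     (exists f1, P f1 /\ forall x y, G0 x y ->
        is_derive (fun t => f t y) x (f1 x y)) /\
     (exists f2, P f2 /\ forall x y, G0 x y ->
        is_derive (fun t => f x t) y (f2 x y))) ->
  forall f, P f -> smooth f.
Proof.
intros HP f Hf n; revert f Hf; induction n as [|n IH]; intros f Hf x y Hxy;
  destruct (HP f Hf) as [Hc [[f1 [P1 H1]] [f2 [P2 H2]]]].
- simpl; split; [now apply Hc | exact I].
- simpl; split; [now apply Hc|].
  split; [now exists (f1 x y); apply H1|].
  split; [now exists (f2 x y); apply H2|].
  split.
  + apply ex_diff_n_ext_loc with f1; [|now apply IH].
    destruct (G0_locally_2d x y Hxy) as [d Hd]; exists d; intros u v Hu Hv.
    symmetry; apply is_derive_unique, H1, Hd; assumption.
  + apply ex_diff_n_ext_loc with f2; [|now apply IH].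
    destruct (G0_locally_2d x y Hxy) as [d Hd]; exists d; intros u v Hu Hv.
    symmetry; apply is_derive_unique, H2, Hd; assumption.
Qed.

Lemma smooth_continuity (f : scalar_field) (x y : R) :
  smooth f -> G0 x y -> continuity_2d_pt f x y.
Proof. intros Hf Hxy; exact (proj1 (Hf 0%nat x y Hxy)). Qed.

Lemma smooth_is_derive1 (f : scalar_field) (x y : R) :
  smooth f -> G0 x y -> is_derive (fun t => f t y) x (D1 f x y).
Proof.
intros Hf Hxy; apply Derive_correct.
now destruct (Hf 1%nat x y Hxy) as [_ [H _]].
Qed.

Lemma smooth_is_derive2 (f : scalar_field) (x y : R) :
  smooth f -> G0 x y -> is_derive (fun t => f x t) y (D2 f x y).
Proof.
intros Hf Hxy; apply Derive_correct.
now destruct (Hf 1%nat x y Hxy) as [_ [_ [H _]]].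
Qed.

Lemma smooth_D1 (f : scalar_field) : smooth f -> smooth (D1 f).
Proof. intros Hf n x y Hxy; apply ex_diff_n_deriv_aux1, Hf, Hxy. Qed.

Lemma smooth_D2 (f : scalar_field) : smooth f -> smooth (D2 f).
Proof. intros Hf n x y Hxy; apply ex_diff_n_deriv_aux2, Hf, Hxy. Qed.

Lemma D1_plus (f g : scalar_field) (x y : R) :
  smooth f -> smooth g -> G0 x y ->
  D1 (fun s t => f s t + g s t) x y = D1 f x y + D1 g x y.
Proof.
intros Hf Hg Hxy.
exact (Derive_plus _ _ _ (ex_intro _ _ (smooth_is_derive1 f x y Hf Hxy))
                       (ex_intro _ _ (smooth_is_derive1 g x y Hg Hxy))).
Qed.

Lemma D1_mult (f g : scalar_field) (x y : R) :
  smooth f -> smooth g -> G0 x y ->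
  D1 (fun s t => f s t * g s t) x y = D1 f x y * g x y + f x y * D1 g x y.
Proof.
intros Hf Hg Hxy.
exact (Derive_mult _ _ _ (ex_intro _ _ (smooth_is_derive1 f x y Hf Hxy))
                       (ex_intro _ _ (smooth_is_derive1 g x y Hg Hxy))).
Qed.

Lemma D2_plus (f g : scalar_field) (x y : R) :
  smooth f -> smooth g -> G0 x y ->
  D2 (fun s t => f s t + g s t) x y = D2 f x y + D2 g x y.
Proof.
intros Hf Hg Hxy.
exact (Derive_plus _ _ _ (ex_intro _ _ (smooth_is_derive2 f x y Hf Hxy))
                       (ex_intro _ _ (smooth_is_derive2 g x y Hg Hxy))).
Qed.

Lemma D2_mult (f g : scalar_field) (x y : R) :
  smooth f -> smooth g -> G0 x y ->
  D2 (fun s t => f s t * g s t) x y = D2 f x y * g x y + f x y * D2 g x y.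
Proof.
intros Hf Hg Hxy.
exact (Derive_mult _ _ _ (ex_intro _ _ (smooth_is_derive2 f x y Hf Hxy))
                       (ex_intro _ _ (smooth_is_derive2 g x y Hg Hxy))).
Qed.

Lemma smooth_const (c : R) : smooth (fun _ _ => c).
Proof.
apply (smooth_class (fun f => exists c, f = fun _ _ => c)); [|now exists c].
intros f [k ->]; split; [|split].
- intros; apply continuity_2d_pt_const.
- exists (fun _ _ => 0); split; [now exists 0|].
  intros; auto_derive; [easy | ring].
- exists (fun _ _ => 0); split; [now exists 0|].
  intros; auto_derive; [easy | ring].
Qed.

Inductive smooth_alg : scalar_field -> Prop :=
| sa_smooth f : smooth f -> smooth_alg f
| sa_plus f g : smooth_alg f -> smooth_alg g -> smooth_alg (fun x y => f x y + g x y)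
| sa_mult f g : smooth_alg f -> smooth_alg g -> smooth_alg (fun x y => f x y * g x y)
| sa_x : smooth_alg (fun x _ => x)
| sa_inv : smooth_alg (fun x _ => / x).

Lemma smooth_alg_smooth (f : scalar_field) : smooth_alg f -> smooth f.
Proof.
apply smooth_class; clear f; intros f Hf.
induction Hf as [f Hf | f g Hf IHf Hg IHg | f g Hf IHf Hg IHg | | ].
- split; [|split].
  + intros; now apply smooth_continuity.
  + exists (D1 f); split; [now apply sa_smooth, smooth_D1|].
    intros; now apply smooth_is_derive1.
  + exists (D2 f); split; [now apply sa_smooth, smooth_D2|].
    intros; now apply smooth_is_derive2.
- destruct IHf as [Cf [[f1 [Pf1 Hf1]] [f2 [Pf2 Hf2]]]].
  destruct IHg as [Cg [[g1 [Pg1 Hg1]] [g2 [Pg2 Hg2]]]].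
  split; [|split].
  + intros; apply continuity_2d_pt_plus; auto.
  + exists (fun x y => f1 x y + g1 x y); split; [now apply sa_plus|].
    intros; apply @is_derive_plus; auto.
  + exists (fun x y => f2 x y + g2 x y); split; [now apply sa_plus|].
    intros; apply @is_derive_plus; auto.
- destruct IHf as [Cf [[f1 [Pf1 Hf1]] [f2 [Pf2 Hf2]]]].
  destruct IHg as [Cg [[g1 [Pg1 Hg1]] [g2 [Pg2 Hg2]]]].
  split; [|split].
  + intros; apply continuity_2d_pt_mult; auto.
  + exists (fun x y => f1 x y * g x y + f x y * g1 x y).
    split; [now apply sa_plus; apply sa_mult|].
    intros x y Hxy.
    apply (is_derive_mult (fun t => f t y) (fun t => g t y) x); auto.
    exact Rmult_comm.
  + exists (fun x y => f2 x y * g x y + f x y * g2 x y).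
    split; [now apply sa_plus; apply sa_mult|].
    intros x y Hxy.
    apply (is_derive_mult (fun t => f x t) (fun t => g x t) y); auto.
    exact Rmult_comm.
- split; [|split].
  + intros; apply continuity_2d_pt_id1.
  + exists (fun _ _ => 1); split; [apply sa_smooth, smooth_const|].
    intros; auto_derive; [easy | ring].
  + exists (fun _ _ => 0); split; [apply sa_smooth, smooth_const|].
    intros; auto_derive; [easy | ring].
- split; [|split].
  + intros x y Hxy; apply continuity_2d_pt_inv; [apply continuity_2d_pt_id1|].
    unfold G0 in Hxy; lra.
  + exists (fun x y => -1 * (/ x * / x)); split.
    { apply (sa_mult (fun _ _ => -1) (fun x y => / x * / x)).
      - apply sa_smooth, smooth_const.
      - apply (sa_mult (fun x _ => / x) (fun x _ => / x)); apply sa_inv. }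
    unfold G0; intros; auto_derive; [lra | field; lra].
  + exists (fun _ _ => 0); split; [apply sa_smooth, smooth_const|].
    intros; auto_derive; [easy | ring].
Qed.

Lemma smooth_plus (f g : scalar_field) :
  smooth f -> smooth g -> smooth (fun x y => f x y + g x y).
Proof. intros; apply smooth_alg_smooth, sa_plus; now apply sa_smooth. Qed.

Lemma smooth_mult (f g : scalar_field) :
  smooth f -> smooth g -> smooth (fun x y => f x y * g x y).
Proof. intros; apply smooth_alg_smooth, sa_mult; now apply sa_smooth. Qed.

Lemma smooth_x : smooth (fun x _ => x).
Proof. apply smooth_alg_smooth, sa_x. Qed.

Lemma smooth_inv_x : smooth (fun x _ => / x).
Proof. apply smooth_alg_smooth, sa_inv. Qed.

Lemma smooth2_left_inv_field (a : R * R) : smooth2 (left_inv_field a).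
Proof.
assert (H : forall c, smooth (fun x _ => x * c))
  by (intros c; apply (smooth_mult (fun x _ => x) (fun _ _ => c));
      [apply smooth_x | apply smooth_const]).
split; intros n x y Hxy.
- apply ex_diff_n_ext_loc with (fun x _ => x * fst a); [|now apply H].
  apply locally_2d_forall; intros; now rewrite left_inv_field_eq.
- apply ex_diff_n_ext_loc with (fun x _ => x * snd a); [|now apply H].
  apply locally_2d_forall; intros; now rewrite left_inv_field_eq.
Qed.

(* Existence of the connection determined by a bilinear product. *)
Lemma left_inv_connection_exists (u11 u12 u21 u22 : R * R) :
  exists nabla,
    left_inv_connection_of (bilinear_product u11 u12 u21 u22) nabla.
Proof.
set (m := bilinear_product u11 u12 u21 u22).
(* With X = x . A and Y = x . B in the frame, nabla_X Y = x . (X(B) + A B). *)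
exists (fun X Y x y =>
  (x * vf_apply X (fun s t => / s * fst (Y s t)) x y
     + / x * fst (m (X x y) (Y x y)),
   x * vf_apply X (fun s t => / s * snd (Y s t)) x y
     + / x * snd (m (X x y) (Y x y)))).
assert (Sinv : forall f : scalar_field, smooth f -> smooth (fun x y => / x * f x y))
  by (intros; apply (smooth_mult (fun x _ => / x)); auto using smooth_inv_x).
assert (Sx : forall f : scalar_field, smooth f -> smooth (fun x y => x * f x y))
  by (intros; apply (smooth_mult (fun x _ => x)); auto using smooth_x).
assert (Sap : forall X f, smooth2 X -> smooth f -> smooth (vf_apply X f)).
{ intros X f [HX1 HX2] Hf; apply smooth_plus; apply smooth_mult;
    auto using smooth_D1, smooth_D2. }
assert (Sm : forall X Y, smooth2 X -> smooth2 Y ->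
  smooth2 (fun x y => m (X x y) (Y x y))).
{ intros X Y [HX1 HX2] [HY1 HY2]; unfold m, bilinear_product, scal, plus; simpl;
    unfold mult, plus; simpl.
  split; simpl; repeat first [ assumption | apply smooth_const
    | apply (smooth_plus (fun x y => _) (fun x y => _))
    | apply (smooth_mult (fun x y => _) (fun x y => _)) ]. }
assert (apE : forall X f g x y, G0 x y -> eq_on_G0 f g ->
  vf_apply X f x y = vf_apply X g x y).
{ intros X f g x y Hxy E; unfold vf_apply, D1, D2; f_equal; f_equal.
  - apply Derive_ext_loc. generalize (G0_locally_1 x y Hxy).
    apply filter_imp; intros t Ht; now apply E.
  - apply Derive_ext; intros t; now apply E. }
assert (apD : forall X f g x y, smooth f -> smooth g -> G0 x y ->
  vf_apply X (fun s t => f s t + g s t) x y = vf_apply X f x y + vf_apply X g x y).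
{ intros X f g x y Hf Hg Hxy; unfold vf_apply.
  rewrite D1_plus, D2_plus by assumption; ring. }
assert (apM : forall X f g x y, smooth f -> smooth g -> G0 x y ->
  vf_apply X (fun s t => f s t * g s t) x y
    = vf_apply X f x y * g x y + f x y * vf_apply X g x y).
{ intros X f g x y Hf Hg Hxy; unfold vf_apply.
  rewrite D1_mult, D2_mult by assumption; ring. }
split; [split|].
- intros X Y HX HY; pose proof (Sm X Y HX HY) as [M1 M2].
  destruct HY as [HY1 HY2].
  split; simpl; apply smooth_plus; auto.
- intros X X' Y Y' _ _ _ _ EX EY x y Hxy; rewrite (EX x y Hxy), (EY x y Hxy).
  rewrite (apE X (fun s t => / s * fst (Y s t)) (fun s t => / s * fst (Y' s t)));
    [|exact Hxy | intros s t Hs; simpl; now rewrite EY].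
  rewrite (apE X (fun s t => / s * snd (Y s t)) (fun s t => / s * snd (Y' s t)));
    [|exact Hxy | intros s t Hs; simpl; now rewrite EY].
  unfold vf_apply; now rewrite (EX x y Hxy).
- intros X X' Y _ _ _ x y Hxy; unfold m, vf_apply; rewrite !vf_plus_eq, !bilinear_product_eq.
  apply injective_projections; simpl; ring.
- intros f X Y _ _ _ x y Hxy; unfold m, vf_apply; rewrite !vf_scal_eq, !bilinear_product_eq.
  apply injective_projections; simpl; ring.
- intros X Y Y' HX [HY1 HY2] [HY1' HY2'] x y Hxy.
  rewrite (apE X (fun s t => / s * fst (vf_plus Y Y' s t))
                 (fun s t => / s * fst (Y s t) + / s * fst (Y' s t)));
    [|exact Hxy | intros s t _; rewrite vf_plus_eq; simpl; ring].
  rewrite (apE X (fun s t => / s * snd (vf_plus Y Y' s t))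
                 (fun s t => / s * snd (Y s t) + / s * snd (Y' s t)));
    [|exact Hxy | intros s t _; rewrite vf_plus_eq; simpl; ring].
  rewrite !(apD X (fun s t => / s * _) (fun s t => / s * _)) by auto.
  unfold m; rewrite !vf_plus_eq, !bilinear_product_eq.
  apply injective_projections; simpl; ring.
- intros f X Y Hf HX [HY1 HY2] x y Hxy.
  rewrite (apE X (fun s t => / s * fst (vf_scal f Y s t))
                 (fun s t => f s t * (/ s * fst (Y s t))));
    [|exact Hxy | intros s t _; rewrite vf_scal_eq; simpl; ring].
  rewrite (apE X (fun s t => / s * snd (vf_scal f Y s t))
                 (fun s t => f s t * (/ s * snd (Y s t))));
    [|exact Hxy | intros s t _; rewrite vf_scal_eq; simpl; ring].
  rewrite !(apM X f (fun s t => / s * _)) by auto.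
  unfold m; rewrite !vf_plus_eq, !vf_scal_eq, !bilinear_product_eq.
  unfold G0 in Hxy; apply injective_projections; simpl; field; lra.
- intros a b x y Hxy; rewrite !left_inv_field_eq.
  rewrite (apE _ (fun s t => / s * fst (left_inv_field b s t)) (fun _ _ => fst b));
    [|exact Hxy | intros s t Hs; unfold G0 in Hs; cbv beta; rewrite left_inv_field_eq; simpl; field; lra].
  rewrite (apE _ (fun s t => / s * snd (left_inv_field b s t)) (fun _ _ => snd b));
    [|exact Hxy | intros s t Hs; unfold G0 in Hs; cbv beta; rewrite left_inv_field_eq; simpl; field; lra].
  unfold vf_apply, D1, D2; rewrite !Derive_const; unfold m; rewrite !bilinear_product_eq.
  unfold G0 in Hxy; apply injective_projections; simpl; field; lra.
Qed.

(* Main.v *)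
Require Import Defs.
From Stdlib Require Import Reals Lra.
From Coquelicot Require Import Coquelicot.
Open Scope R_scope.

(** Both maps are power shears (x, y) |-> (a x, c x^p + a y + d), with p = -1
    for F and p = 1/2 for G, and both assertions are proved for power shears.
    On the half-plane x > 0 they are closed under composition and inversion,
    hence diffeomorphisms, and their Jacobian matrix is triangular with both
    diagonal entries equal to a. So dx /\ dy is multiplied by a^2, exactly as
    x^2 is, and omega^+ is preserved ([symplectomorphism_power_shear]).

    For the affine property, a left invariant connection is determined by its
    product: writing X = A^i e_i^+ and Y = B^j e_j^+, one has
    nabla_X Y = X(B^j) e_j^+ + A^i B^j (e_i e_j)^+
    ([left_inv_connection_formula]). A power shear sends e_2^+ to itself and
    e_1^+ to e_1^+ + psi e_2^+, with psi a multiple of x^(p-1). Pushing the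
    formula forward with the chain rule ([vf_apply_pushforward]) for a product
    e_1 e_1 = l e_1, e_1 e_2 = q e_2, e_2 e_1 = r e_2, e_2 e_2 = 0 leaves the
    single condition x psi' = (l - q - r) psi, that is p - 1 = l - q - r
    ([affine_transformation_power_shear]). The first product has
    l - q - r = -1 - 1 - 0 = -2 and the second
    l - q - r = -1/2 - 1/2 + 1/2 = -1/2, which are the two exponents.

    The functions 1/x and sqrt x agree with real powers of x only for x > 0;
    this is why the properties at stake are first shown to depend only on the
    values of the map on G0. *)

(** * Smooth functions and the chain rule *)

Lemma eq_on_G0_locally_2d {T : Type} (X Y : R -> R -> T) (x y : R) :
  eq_on_G0 X Y -> G0 x y -> locally_2d (fun s t => X s t = Y s t) x y.
Proof.
intros E Hxy; destruct (G0_locally_2d x y Hxy) as [e He].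
exists e; intros s t Hs Ht; apply E, He; assumption.
Qed.

Lemma smooth_ext (f g : scalar_field) :
  eq_on_G0 f g -> smooth f -> smooth g.
Proof.
intros E Hf n x y Hxy; apply ex_diff_n_ext_loc with f; [|now apply Hf].
now apply eq_on_G0_locally_2d.
Qed.

Lemma smooth2_ext (X Y : R -> R -> R * R) :
  eq_on_G0 X Y -> smooth2 X -> smooth2 Y.
Proof.
intros E [H1 H2]; split.
- apply smooth_ext with (2 := H1); intros x y Hxy; now rewrite E.
- apply smooth_ext with (2 := H2); intros x y Hxy; now rewrite E.
Qed.

Lemma smooth2_vf_plus (X Y : vector_field) :
  smooth2 X -> smooth2 Y -> smooth2 (vf_plus X Y).
Proof.
intros [HX1 HX2] [HY1 HY2]; split; now apply smooth_plus.
Qed.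

Lemma smooth2_vf_scal (f : scalar_field) (X : vector_field) :
  smooth f -> smooth2 X -> smooth2 (vf_scal f X).
Proof. intros Hf [HX1 HX2]; split; now apply smooth_mult. Qed.

Lemma D1_ext (f g : scalar_field) (x y : R) :
  eq_on_G0 f g -> G0 x y -> D1 f x y = D1 g x y.
Proof.
intros E Hxy; apply Derive_ext_loc.
generalize (G0_locally_1 x y Hxy); apply filter_imp; intros t Ht; now apply E.
Qed.

Lemma D2_ext (f g : scalar_field) (x y : R) :
  eq_on_G0 f g -> G0 x y -> D2 f x y = D2 g x y.
Proof. intros E Hxy; apply Derive_ext; intros t; now apply E. Qed.

Lemma differential_ext (F F' : plane_map) (x y : R) (v : R * R) :
  eq_on_G0 F F' -> G0 x y -> Defs.differential F x y v = Defs.differential F' x y v.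
Proof.
intros E Hxy; unfold Defs.differential.
assert (E1 : eq_on_G0 (fun s t => fst (F s t)) (fun s t => fst (F' s t)))
  by (intros s t Hst; now rewrite E).
assert (E2 : eq_on_G0 (fun s t => snd (F s t)) (fun s t => snd (F' s t)))
  by (intros s t Hst; now rewrite E).
now rewrite (D1_ext _ _ x y E1), (D2_ext _ _ x y E1),
  (D1_ext _ _ x y E2), (D2_ext _ _ x y E2).
Qed.

(** Separate partial derivatives would not suffice for the chain rule; the
    continuity of the first one upgrades them to joint differentiability. *)
Lemma smooth_differentiable (f : scalar_field) (x y : R) :
  smooth f -> G0 x y ->
  differentiable_pt_lim f x y (D1 f x y) (D2 f x y).
Proof.
intros Hf Hxy; apply filterdiff_differentiable_pt_lim.
apply (is_derive_filterdiff f x y (D1 f) (D2 f x y)).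
- apply (locally_2d_locally (fun s t => is_derive (fun z => f z t) s (D1 f s t))).
  destruct (G0_locally_2d x y Hxy) as [e He]; exists e; intros s t Hs Ht.
  apply smooth_is_derive1; [assumption | now apply He].
- now apply smooth_is_derive2.
- apply (continuity_2d_pt_filterlim (D1 f)), smooth_continuity; [|assumption].
  now apply smooth_D1.
Qed.

Lemma vf_apply_ext (X : vector_field) (f g : scalar_field) (x y : R) :
  eq_on_G0 f g -> G0 x y -> vf_apply X f x y = vf_apply X g x y.
Proof.
intros E Hxy; unfold vf_apply; now rewrite (D1_ext f g), (D2_ext f g).
Qed.

(** The chain rule: (F_* X)(f) at F(x, y) is X(f o F) at (x, y). It turns
    derivatives of the pushed-forward components, which are known only
    through their composites with F, into derivatives at the source point. *)
Lemma vf_apply_pushforward (F : plane_map) (X X' : vector_field)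
    (f : scalar_field) (x y : R) :
  maps_G0 F -> smooth2 F -> is_pushforward F X X' -> smooth f -> G0 x y ->
  vf_apply X' f (fst (F x y)) (snd (F x y))
    = vf_apply X (fun s t => f (fst (F s t)) (snd (F s t))) x y.
Proof.
intros MF [SF1 SF2] HX Hf Hxy.
assert (Hd := smooth_differentiable f _ _ Hf (MF x y Hxy)).
assert (E1 : D1 (fun s t => f (fst (F s t)) (snd (F s t))) x y
  = D1 f (fst (F x y)) (snd (F x y)) * D1 (fun s t => fst (F s t)) x y
    + D2 f (fst (F x y)) (snd (F x y)) * D1 (fun s t => snd (F s t)) x y).
{ apply is_derive_unique, is_derive_Reals.
  apply (derivable_pt_lim_comp_2d f (fun s => fst (F s y)) (fun s => snd (F s y)));
    [exact Hd | |]; apply is_derive_Reals.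
  - exact (smooth_is_derive1 _ x y SF1 Hxy).
  - exact (smooth_is_derive1 _ x y SF2 Hxy). }
assert (E2 : D2 (fun s t => f (fst (F s t)) (snd (F s t))) x y
  = D1 f (fst (F x y)) (snd (F x y)) * D2 (fun s t => fst (F s t)) x y
    + D2 f (fst (F x y)) (snd (F x y)) * D2 (fun s t => snd (F s t)) x y).
{ apply is_derive_unique, is_derive_Reals.
  apply (derivable_pt_lim_comp_2d f (fun t => fst (F x t)) (fun t => snd (F x t)));
    [exact Hd | |]; apply is_derive_Reals.
  - exact (smooth_is_derive2 _ x y SF1 Hxy).
  - exact (smooth_is_derive2 _ x y SF2 Hxy). }
unfold vf_apply; rewrite E1, E2, (HX x y Hxy); unfold Defs.differential; simpl; ring.
Qed.

Lemma diffeomorphism_ext (F F' : plane_map) :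
  eq_on_G0 F F' -> diffeomorphism F -> diffeomorphism F'.
Proof.
intros E [MF [SF [H [MH [SH [HF FH]]]]]]; split; [|split].
- intros x y Hxy; rewrite <- E by assumption; now apply MF.
- now apply smooth2_ext with F.
- exists H; split; [assumption | split; [assumption | split]].
  + intros x y Hxy; rewrite <- E by assumption; now apply HF.
  + intros x y Hxy; rewrite <- E by now apply MH.
    now apply FH.
Qed.

Lemma symplectomorphism_ext (w : two_form) (F F' : plane_map) :
  eq_on_G0 F F' -> symplectomorphism w F -> symplectomorphism w F'.
Proof.
intros E [DF HF]; split; [now apply diffeomorphism_ext with F|].
intros x y Hxy u v; rewrite <- (HF x y Hxy u v); unfold pullback.
now rewrite <- E, <- !(differential_ext F F' x y _ E Hxy) by assumption.
Qed.

Lemma is_pushforward_ext (F F' : plane_map) (X X' : vector_field) :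
  eq_on_G0 F F' -> is_pushforward F X X' -> is_pushforward F' X X'.
Proof.
intros E H x y Hxy.
rewrite <- E, <- (differential_ext F F' x y _ E Hxy) by assumption; now apply H.
Qed.

Lemma affine_transformation_ext (nabla : connection) (F F' : plane_map) :
  eq_on_G0 F F' -> affine_transformation nabla F ->
  affine_transformation nabla F'.
Proof.
intros E [DF HF].
assert (E' : eq_on_G0 F' F) by (intros x y Hxy; symmetry; now apply E).
split; [now apply diffeomorphism_ext with F|].
intros X Y X' Y' SX SY SX' SY' HX HY.
apply is_pushforward_ext with F; [assumption|].
apply HF; try assumption; now apply is_pushforward_ext with F'.
Qed.

(** * Left invariant connections in the left invariant frame *)

(** Components in the frame (e_1^+, e_2^+), which at (x, y) is x times the
    coordinate frame. *)
Definition frame_components (X : vector_field) : vector_field :=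
  vf_scal (fun x _ => / x) X.

Lemma smooth2_frame_components (X : vector_field) :
  smooth2 X -> smooth2 (frame_components X).
Proof. intros HX; apply smooth2_vf_scal; [apply smooth_inv_x | exact HX]. Qed.

Lemma frame_decomposition (X : vector_field) :
  eq_on_G0 X
    (vf_plus (vf_scal (fun x y => fst (frame_components X x y)) (left_inv_field e1))
             (vf_scal (fun x y => snd (frame_components X x y)) (left_inv_field e2))).
Proof.
unfold G0; intros x y Hxy; unfold G0 in Hxy; unfold frame_components.
rewrite vf_plus_eq, !vf_scal_eq, left_inv_field_e1, left_inv_field_e2.
apply injective_projections; simpl; field; lra.
Qed.

(** Tensoriality in the first argument and the Leibniz rule in the second one
    leave only the values on the frame, which the product prescribes: with
    X = A^i e_i^+ and Y = B^j e_j^+, one has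
    nabla_X Y = X(B^j) e_j^+ + A^i B^j (e_i e_j)^+. *)
Lemma left_inv_connection_formula (u11 u12 u21 u22 : R * R) (nabla : connection)
    (X Y : vector_field) (x y : R) :
  left_inv_connection_of (bilinear_product u11 u12 u21 u22) nabla ->
  smooth2 X -> smooth2 Y -> G0 x y ->
  let m := bilinear_product u11 u12 u21 u22
             (frame_components X x y) (frame_components Y x y) in
  nabla X Y x y =
  (x * (vf_apply X (fun s t => fst (frame_components Y s t)) x y + fst m),
   x * (vf_apply X (fun s t => snd (frame_components Y s t)) x y + snd m)).
Proof.
intros [C L] SX SY Hxy m.
assert (DX := frame_decomposition X); assert (DY := frame_decomposition Y).
assert (SA := smooth2_frame_components X SX).
assert (SB := smooth2_frame_components Y SY).
revert m DX DY SA SB.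
generalize (frame_components X) (frame_components Y); intros A B m DX DY [SA1 SA2] [SB1 SB2].
assert (Se1 := smooth2_left_inv_field e1); assert (Se2 := smooth2_left_inv_field e2).
assert (SE : forall f e, smooth f -> smooth2 (vf_scal f (left_inv_field e)))
  by (intros; apply smooth2_vf_scal; auto using smooth2_left_inv_field).
assert (HX : forall e, nabla X (left_inv_field e) x y =
  let Z1 := left_inv_field (bilinear_product u11 u12 u21 u22 e1 e) x y in
  let Z2 := left_inv_field (bilinear_product u11 u12 u21 u22 e2 e) x y in
  (fst (A x y) * fst Z1 + snd (A x y) * fst Z2,
   fst (A x y) * snd Z1 + snd (A x y) * snd Z2)).
{ intros e; assert (Se := smooth2_left_inv_field e).
  rewrite (conn_ext nabla C X _ _ _ SX (smooth2_vf_plus _ _ (SE _ e1 SA1) (SE _ e2 SA2))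
             Se Se DX (fun _ _ _ => eq_refl) x y Hxy).
  rewrite (conn_plus_l nabla C _ _ _ (SE _ e1 SA1) (SE _ e2 SA2) Se x y Hxy).
  rewrite vf_plus_eq.
  rewrite (conn_scal_l nabla C _ _ _ SA1 Se1 Se x y Hxy).
  rewrite (conn_scal_l nabla C _ _ _ SA2 Se2 Se x y Hxy).
  now rewrite !vf_scal_eq, !(L _ e x y Hxy). }
rewrite (conn_ext nabla C X _ _ _ SX SX SY
           (smooth2_vf_plus _ _ (SE _ e1 SB1) (SE _ e2 SB2))
           (fun _ _ _ => eq_refl) DY x y Hxy).
rewrite (conn_plus_r nabla C _ _ _ SX (SE _ e1 SB1) (SE _ e2 SB2) x y Hxy), vf_plus_eq.
rewrite (conn_leibniz nabla C _ _ _ SB1 SX Se1 x y Hxy).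
rewrite (conn_leibniz nabla C _ _ _ SB2 SX Se2 x y Hxy).
rewrite !vf_plus_eq, !vf_scal_eq, !HX; unfold m.
rewrite !left_inv_field_eq, !bilinear_product_eq.
apply injective_projections; simpl; ring.
Qed.

(** * Power shears *)

Definition power_shear (a c p d : R) : plane_map :=
  fun x y => (a * x, c * Rpower x p + a * y + d).

Lemma is_derive_power_affine (c p l x : R) : 0 < x ->
  is_derive (fun t => c * Rpower t p + l) x (c * p * Rpower x (p - 1)).
Proof.
intros Hx.
assert (H : is_derive (fun t : R => Rpower t p) x (p * Rpower x (p - 1)))
  by now apply is_derive_Reals, derivable_pt_lim_power.
auto_derive; [now exists (p * Rpower x (p - 1))|].
rewrite (is_derive_unique (fun t : R => Rpower t p) _ _ H); ring.
Qed.

(** With c, p, k, l all allowed to vary, the class of these functions is stable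
    under both partial derivatives. *)
Lemma smooth_power_affine (c p k l : R) :
  smooth (fun x y => c * Rpower x p + k * y + l).
Proof.
apply (smooth_class (fun f => exists c p k l,
         f = fun x y => c * Rpower x p + k * y + l)); [|now exists c, p, k, l].
clear; intros f [c [p [k [l ->]]]]; unfold G0; split; [|split].
- intros x y Hx.
  apply continuity_2d_pt_plus; [apply continuity_2d_pt_plus|];
    try apply continuity_2d_pt_mult; try apply continuity_2d_pt_const.
  + apply (continuity_1d_2d_pt_comp (fun t => Rpower t p) (fun s _ => s));
      [|apply continuity_2d_pt_id1].
    apply derivable_continuous_pt; exists (p * Rpower x (p - 1)).
    now apply derivable_pt_lim_power.
  + apply continuity_2d_pt_id2.
- exists (fun x y => (c * p) * Rpower x (p - 1) + 0 * y + 0); split;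
    [now exists (c * p), (p - 1), 0, 0|].
  intros x y Hx; apply (is_derive_ext (fun t => c * Rpower t p + (k * y + l)));
    [intros t; symmetry; apply Rplus_assoc|].
  replace (c * p * Rpower x (p - 1) + 0 * y + 0)
    with (c * p * Rpower x (p - 1)) by ring.
  now apply is_derive_power_affine.
- exists (fun x y => 0 * Rpower x p + 0 * y + k); split;
    [now exists 0, p, 0, k|].
  intros x y _; auto_derive; [easy | ring].
Qed.

Lemma smooth2_power_shear (a c p d : R) : smooth2 (power_shear a c p d).
Proof.
split; simpl.
- apply (smooth_mult (fun _ _ => a) (fun x _ => x));
    [apply smooth_const | apply smooth_x].
- apply smooth_power_affine.
Qed.

Lemma maps_G0_power_shear (a c p d : R) : 0 < a -> maps_G0 (power_shear a c p d).
Proof. intros Ha x y Hx; now apply Rmult_lt_0_compat. Qed.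

Lemma power_shear_comp (a c d a' c' d' p x y : R) : 0 < a -> 0 < x ->
  power_shear a' c' p d' (a * x) (c * Rpower x p + a * y + d)
  = power_shear (a' * a) (c' * Rpower a p + a' * c) p (a' * d + d') x y.
Proof.
intros Ha Hx; unfold power_shear.
rewrite <- Rpower_mult_distr by assumption.
apply injective_projections; simpl; ring.
Qed.

Lemma diffeomorphism_power_shear (a c p d : R) :
  0 < a -> diffeomorphism (power_shear a c p d).
Proof.
intros Ha.
assert (Ha' : 0 < / a) by now apply Rinv_0_lt_compat.
assert (Hi : Rpower a p * Rpower (/ a) p = 1).
{ rewrite Rpower_mult_distr, Rinv_r by lra.
  unfold Rpower; now rewrite ln_1, Rmult_0_r, exp_0. }
split; [now apply maps_G0_power_shear|].
split; [apply smooth2_power_shear|].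
(* The inverse, read off from the composition law of power shears. *)
exists (power_shear (/ a) (- (/ a * c) * Rpower (/ a) p) p (- (/ a * d))).
split; [now apply maps_G0_power_shear|].
split; [apply smooth2_power_shear|].
split; intros x y Hx.
- change (power_shear (/ a) (- (/ a * c) * Rpower (/ a) p) p (- (/ a * d))
    (a * x) (c * Rpower x p + a * y + d) = (x, y)).
  rewrite power_shear_comp by assumption; unfold power_shear.
  replace (- (/ a * c) * Rpower (/ a) p * Rpower a p)
    with (- (/ a * c) * (Rpower a p * Rpower (/ a) p)) by ring.
  rewrite Hi; apply injective_projections; simpl; field; lra.
- change (power_shear a c p d (/ a * x)
    (- (/ a * c) * Rpower (/ a) p * Rpower x p + / a * y + - (/ a * d)) = (x, y)).
  rewrite power_shear_comp by assumption; unfold power_shear.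
  apply injective_projections; simpl; field; lra.
Qed.

Lemma differential_power_shear (a c p d x y : R) (v : R * R) : G0 x y ->
  Defs.differential (power_shear a c p d) x y v
  = (a * fst v, c * p * Rpower x (p - 1) * fst v + a * snd v).
Proof.
intros Hx; unfold Defs.differential, D1, D2, power_shear; simpl.
assert (E1 : Derive (fun t => a * t) x = a)
  by (apply is_derive_unique; auto_derive; [easy | ring]).
assert (E2 : Derive (fun t => c * Rpower t p + a * y + d) x = c * p * Rpower x (p - 1)).
{ rewrite (Derive_ext _ (fun t => c * Rpower t p + (a * y + d))) by (intros t; ring).
  now apply is_derive_unique, is_derive_power_affine. }
assert (E3 : Derive (fun t => c * Rpower x p + a * t + d) y = a)
  by (apply is_derive_unique; auto_derive; [easy | ring]).
rewrite E1, E2, E3, Derive_const; f_equal; ring.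
Qed.

(** The Jacobian determinant is the constant a^2, which is also the factor
    by which x^2 is multiplied. *)
Lemma symplectomorphism_power_shear (a c p d : R) :
  0 < a -> symplectomorphism omega_plus (power_shear a c p d).
Proof.
intros Ha; split; [now apply diffeomorphism_power_shear|].
intros x y Hxy u v; unfold pullback; rewrite !differential_power_shear by assumption.
unfold omega_plus, power_shear, G0 in *; simpl; field; lra.
Qed.

(** In the left invariant frame the shear sends e_1^+ to e_1^+ + psi e_2^+ and
    fixes e_2^+, where psi = (c p / a) x^(p-1) at the source point. Since
    nabla_(e_2^+) e_2^+ = 0 and psi depends on x only, the sole identity to
    check is the e_2^+ component of nabla_(e_1^+) e_1^+, namely
    e_1^+(psi) + (q + r) psi = l psi. As e_1^+(psi) = (p - 1) psi, this is the
    assumption on the exponent. *)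
Lemma affine_transformation_power_shear (l q r a c p d : R) (nabla : connection) :
  left_inv_connection_of (bilinear_product (l, 0) (0, q) (0, r) (0, 0)) nabla ->
  0 < a -> p - 1 = l - q - r ->
  affine_transformation nabla (power_shear a c p d).
Proof.
intros HN Ha Hp; split; [now apply diffeomorphism_power_shear|].
intros X Y X' Y' SX SY SX' SY' HX HY x y Hxy.
set (F := power_shear a c p d) in *.
assert (MF : maps_G0 F) by now apply maps_G0_power_shear.
assert (SF : smooth2 F) by apply smooth2_power_shear.
(* psi is the e_2^+ component of the image of e_1^+, at the source point. *)
set (psi := fun s t : R => c * p / a * Rpower s (p - 1) + 0).
assert (Spsi : smooth psi).
{ apply smooth_ext with (2 := smooth_power_affine (c * p / a) (p - 1) 0 0).
  intros s t _; unfold psi; ring. }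
assert (HE : forall Z Z', is_pushforward F Z Z' -> forall s t, G0 s t ->
  frame_components Z' (fst (F s t)) (snd (F s t)) =
  (fst (frame_components Z s t),
   psi s t * fst (frame_components Z s t) + snd (frame_components Z s t))).
{ intros Z Z' HZ s t Hst; unfold frame_components; rewrite !vf_scal_eq, (HZ s t Hst).
  unfold F; rewrite differential_power_shear by assumption.
  unfold psi, G0 in *; apply injective_projections; simpl; field; lra. }
destruct (smooth2_frame_components Y SY) as [SB1 SB2].
destruct (smooth2_frame_components Y' SY') as [SB1' SB2'].
assert (V1 : vf_apply X' (fun s t => fst (frame_components Y' s t))
               (fst (F x y)) (snd (F x y))
             = vf_apply X (fun s t => fst (frame_components Y s t)) x y).
{ rewrite (vf_apply_pushforward F X X' _ x y MF SF HX SB1' Hxy).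
  apply vf_apply_ext; [|assumption]; intros s t Hst; now rewrite (HE Y Y' HY). }
assert (Dpsi1 : D1 psi x y = (p - 1) * psi x y / x).
{ assert (HR : Rpower x (p - 1 - 1) = Rpower x (p - 1) / x).
  { unfold Rdiv; rewrite <- (Rpower_1 x Hxy) at 3.
    now rewrite <- Rpower_Ropp, <- Rpower_plus. }
  transitivity (c * p / a * (p - 1) * Rpower x (p - 1 - 1));
    [now apply is_derive_unique, is_derive_power_affine|].
  rewrite HR; unfold psi, G0 in *; field; lra. }
assert (Dpsi2 : D2 psi x y = 0)
  by exact (Derive_const (psi x y) y).
assert (V2 : vf_apply X' (fun s t => snd (frame_components Y' s t))
               (fst (F x y)) (snd (F x y))
             = fst (X x y) * ((p - 1) * psi x y / x) * fst (frame_components Y x y)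
               + psi x y * vf_apply X (fun s t => fst (frame_components Y s t)) x y
               + vf_apply X (fun s t => snd (frame_components Y s t)) x y).
{ rewrite (vf_apply_pushforward F X X' _ x y MF SF HX SB2' Hxy).
  rewrite (vf_apply_ext X _ (fun s t => psi s t * fst (frame_components Y s t)
                                + snd (frame_components Y s t)));
    [|intros s t Hst; now rewrite (HE Y Y' HY) | assumption].
  assert (SP := smooth_mult _ _ Spsi SB1).
  unfold vf_apply; rewrite (D1_plus _ _ x y SP SB2 Hxy), (D2_plus _ _ x y SP SB2 Hxy).
  rewrite (D1_mult _ _ x y Spsi SB1 Hxy), (D2_mult _ _ x y Spsi SB1 Hxy).
  rewrite Dpsi1, Dpsi2; ring. }
rewrite (left_inv_connection_formula _ _ _ _ nabla X' Y' _ _ HN SX' SY' (MF x y Hxy)).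
rewrite (left_inv_connection_formula _ _ _ _ nabla X Y _ _ HN SX SY Hxy).
rewrite V1, V2, (HE X X' HX x y Hxy), (HE Y Y' HY x y Hxy).
assert (HX1 : fst (X x y) = x * fst (frame_components X x y)).
{ unfold frame_components; rewrite vf_scal_eq; unfold G0 in Hxy; simpl; field; lra. }
assert (Hc : c * p * Rpower x (p - 1) = a * psi x y) by (unfold psi; field; lra).
rewrite HX1; unfold F; rewrite differential_power_shear by assumption; rewrite Hc, Hp.
rewrite !bilinear_product_eq; unfold G0 in Hxy; simpl.
apply injective_projections; simpl; field; lra.
Qed.

Lemma product1_eq : product1 = bilinear_product (-1, 0) (0, 1) (0, 0) (0, 0).
Proof.
unfold product1; f_equal; apply injective_projections; simpl;
  unfold opp; simpl; ring.
Qed.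

Lemma product2_eq :
  product2 = bilinear_product (- (1 / 2), 0) (0, 1 / 2) (0, - (1 / 2)) (0, 0).
Proof.
unfold product2; f_equal; apply injective_projections; simpl;
  unfold scal; simpl; unfold mult; simpl; ring.
Qed.

Theorem proposition4p2 (nabla1 nabla2 : connection)
    (h1 : left_inv_connection_of product1 nabla1)
    (h2 : left_inv_connection_of product2 nabla2)
    (a b d : R) (ha : 0 < a) :
  let F : plane_map := fun x y => (a * x, - b * / x + a * y + d) in
  let G : plane_map := fun x y => (a * x, - 2 * b * sqrt x + a * y + d) in
  (symplectomorphism omega_plus F /\ affine_transformation nabla1 F) /\
  (symplectomorphism omega_plus G /\ affine_transformation nabla2 G).
Proof.
intros F G.
assert (EF : eq_on_G0 (power_shear a (- b) (- (1)) d) F).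
{ intros x y Hx; unfold power_shear, F.
  now rewrite Rpower_Ropp, Rpower_1 by exact Hx. }
assert (EG : eq_on_G0 (power_shear a (- 2 * b) (/ 2) d) G).
{ intros x y Hx; unfold power_shear, G.
  now rewrite Rpower_sqrt by exact Hx. }
rewrite product1_eq in h1; rewrite product2_eq in h2.
split; split.
- apply (symplectomorphism_ext _ _ _ EF); now apply symplectomorphism_power_shear.
- apply (affine_transformation_ext _ _ _ EF).
  apply (affine_transformation_power_shear _ _ _ _ _ _ _ _ h1 ha); lra.
- apply (symplectomorphism_ext _ _ _ EG); now apply symplectomorphism_power_shear.
- apply (affine_transformation_ext _ _ _ EG).
  apply (affine_transformation_power_shear _ _ _ _ _ _ _ _ h2 ha); lra.
Qed.
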